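(* Let $R$ be a graded principal ideal domain. Then at least one of the following holds: (1) $R = R_0$, i.e., $R$ is an ordinary principal ideal domain with the $0$-grading. (2) The subring $R_0$ is a field, and $R$ is isomorphic as a graded ring to the polynomial ring $R_0[T]$, where the grading on $R_0[T]$ is a multiple of the canonical grading, i.e., there is an $n \in \mathbb{N}_{>0}$ such that for all $k \in \mathbb{N}$ the monomial $T^k$ is homogeneous of degree $n \cdot k$ (so the homogeneous part of degree $nk$ is $R_0 \cdot T^k$ and all homogeneous parts in degrees not divisible by $n$ are $0$).
   Context: $\mathbb{N}$ contains $0$; all gradings are over $\mathbb{N}$. Domains are commutative with unit. A graded ring is a ring $R$ together with additive subgroups $(R_n)_{n \in \mathbb{N}}$ such that $(R,+)$ is the internal direct sum of the $R_n$ and $R_n \cdot R_m \subset R_{n+m}$ for all $n,m \in \mathbb{N}$. Elements of $R_n$ are called homogeneous of degree $n$; an element is homogeneous if it is homogeneous of some degree. A graded principal ideal domain is a graded ring that is a domain and in which every homogeneous ideal (i.e., every ideal generated by homogeneous elements) is generated by a single element. The canonical grading on a polynomial ring $K[T]$ is the one with degree-$n$ part $K \cdot T^n$. The $0$-grading on a ring $R$ is the one with $R_0 = R$ and $R_n = 0$ for $n > 0$. *)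

(* Defs.v *)
From HB Require Import structures.
From mathcomp Require Import all_boot all_order all_algebra.
From mathcomp Require Import boolp classical_sets.
Set Implicit Arguments.
Unset Strict Implicit.
Unset Printing Implicit Defensive.
Import GRing.Theory.
Local Open Scope classical_set_scope.
Local Open Scope ring_scope.

(* [hpart_span] and [hpart_indep] together say that (R, +) is the internal
   direct sum of the subgroups [hpart n]. *)
Record grading (R : pzRingType) := Grading {
  hpart :> nat -> set R;
  hpart0 : forall n, hpart n 0;
  hpartB : forall n x y, hpart n x -> hpart n y -> hpart n (x - y);
  hpartM : forall n m x y, hpart n x -> hpart m y -> hpart (n + m)%N (x * y);
  hpart_span : forall x, exists (N : nat) (f : nat -> R),
    (forall n, hpart n (f n)) /\ x = \sum_(n < N) f n;
  hpart_indep : forall (N : nat) (f : nat -> R),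
    (forall n, hpart n (f n)) -> \sum_(n < N) f n = 0 ->
    forall n, (n < N)%N -> f n = 0
}.

Definition homogeneous (R : pzRingType) (G : grading R) : set R :=
  [set x | exists n, G n x].

(* MathComp's [idealr_closed] only describes proper ideals. *)
Definition is_ideal (R : comNzRingType) (I : set R) : Prop :=
  [/\ I 0, (forall x y, I x -> I y -> I (x + y))
         & (forall a x, I x -> I (a * x))].

Definition ideal_gen (R : comNzRingType) (S : set R) : set R :=
  smallest (@is_ideal R) S.

Definition principal (R : comNzRingType) (I : set R) : Prop :=
  exists a : R, I = ideal_gen [set a].

Definition is_pid (R : idomainType) : Prop :=
  forall I : set R, is_ideal I -> principal I.

Definition homogeneous_ideal (R : comNzRingType) (G : grading R) (I : set R) :
    Prop :=
  exists2 S : set R, S `<=` homogeneous G & I = ideal_gen S.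

Definition is_graded_pid (R : idomainType) (G : grading R) : Prop :=
  forall I : set R, homogeneous_ideal G I -> principal I.

Definition is_zero_grading (R : pzRingType) (G : grading R) : Prop :=
  G 0%N = setT /\ forall n, (0 < n)%N -> G n = [set 0].

Definition is_field (K : comNzRingType) : Prop :=
  forall x : K, x != 0 -> exists y : K, x * y = 1.

Definition graded_isomorphic (R S : pzRingType) (G : grading R)
    (H : grading S) : Prop :=
  exists f : {rmorphism R -> S}, bijective f /\ forall n, f @` G n = H n.

Section DegreeZero.
Variables (R : comNzRingType) (G : grading R).

Lemma hpart_sub0 n x : G n x -> G n (- x).
Proof. by move=> Gx; rewrite -sub0r; apply: hpartB => //; apply: hpart0. Qed.

Lemma hpart0_1 : G 0%N 1.
Proof.
have [N [e [Ge e1]]] := hpart_span G 1.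
have [N0|N_gt0] := posnP N.
  by rewrite e1 N0 big_ord0; apply: hpart0.
have xe n x : G n x -> x = x * e 0%N.
  move=> Gx.
  pose g j := (if (j < n)%N then 0 else x * e (j - n)%N) -
              (if j == n then x else 0).
  have Gg j : G j (g j).
    apply: hpartB.
      case: ltnP => [_|le_nj]; first exact: hpart0.
      by rewrite -{1}(subnKC le_nj); apply: hpartM.
    by case: eqP => [->|_] //; apply: hpart0.
  have sg : \sum_(j < n + N) g j = 0.
    rewrite /g sumrB big_split_ord /= big1 ?add0r; last first.
      by move=> i _; rewrite ltn_ord.
    under eq_bigr => i _ do rewrite ltnNge leq_addr /= addKn.
    rewrite -mulr_sumr -e1 mulr1 -big_mkcond /=.
    have lt_n : (n < n + N)%N by rewrite -addn1 leq_add2l.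
    rewrite (eq_bigl (fun i => i == Ordinal lt_n)) ?big_pred1_eq ?subrr //.
  have := hpart_indep Gg sg (n := n).
  rewrite /g ltnn eqxx subnn -addn1 leq_add2l => /(_ N_gt0) /eqP.
  by rewrite subr_eq0 => /eqP.
suff -> : 1 = e 0%N by [].
rewrite -[RHS]mul1r [in RHS]e1 mulr_suml e1.
by apply: eq_bigr => i _; apply: xe (Ge i).
Qed.

Definition in_hpart0 : {pred R} := fun x => `[< G 0%N x >].

Lemma in_hpart0_subring : subring_closed in_hpart0.
Proof.
split.
- exact/asboolP/hpart0_1.
- by move=> x y /asboolP Gx /asboolP Gy; apply/asboolP; apply: hpartB.
- by move=> x y /asboolP Gx /asboolP Gy; apply/asboolP; apply: (hpartM Gx Gy).
Qed.

HB.instance Definition _ :=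
  GRing.isSubringClosed.Build R in_hpart0 in_hpart0_subring.

Record degree0 := Degree0 {
  degree0_val :> R;
  degree0_valP : degree0_val \in in_hpart0
}.

HB.instance Definition _ := [isSub for degree0_val].
HB.instance Definition _ := [Choice of degree0 by <:].
HB.instance Definition _ := [SubChoice_isSubComNzRing of degree0 by <:].

End DegreeZero.

Section PolyGrading.
Variables (K : comNzRingType) (n : nat) (n_gt0 : (0 < n)%N).

Definition poly_hpart (d : nat) : set {poly K} :=
  if (n %| d)%N then [set p | exists c : K, p = c *: 'X^(d %/ n)]
  else [set 0].

Lemma poly_hpartP d p : poly_hpart d p <-> forall i, p`_i != 0 -> d = (n * i)%N.
Proof.
rewrite /poly_hpart; case: ifPn => [dvd|ndvd] /=; split.
- move=> [c ->] i; rewrite coefZ coefXn; case: (i =P _) => [->|_].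
    by move=> _; rewrite mulnC divnK.
  by rewrite mulr0 eqxx.
- move=> h; exists p`_(d %/ n); apply/polyP => i; rewrite coefZ coefXn.
  case: eqP => [->|ne]; first by rewrite mulr1.
  rewrite mulr0; apply/eqP; apply/negPn/negP => /h de.
  by apply: ne; rewrite de mulKn.
- by move=> -> i; rewrite coef0 eqxx.
- move=> h; apply/polyP => i; rewrite coef0; apply/eqP/negPn/negP => /h de.
  by rewrite de dvdn_mulr in ndvd.
Qed.

Fact poly_hpart0 d : poly_hpart d 0.
Proof. by apply/poly_hpartP => i; rewrite coef0 eqxx. Qed.

Fact poly_hpartB d p q :
  poly_hpart d p -> poly_hpart d q -> poly_hpart d (p - q).
Proof.
move=> /poly_hpartP hp /poly_hpartP hq; apply/poly_hpartP => i.
rewrite coefB; have [p0|/hp //] := eqVneq p`_i 0.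
by rewrite p0 sub0r oppr_eq0 => /hq.
Qed.

Fact poly_hpartM d e p q :
  poly_hpart d p -> poly_hpart e q -> poly_hpart (d + e)%N (p * q).
Proof.
move=> /poly_hpartP hp /poly_hpartP hq; apply/poly_hpartP => i nz.
apply: contrapT => ne; move/eqP: nz; apply.
rewrite coefM big1 // => j _.
have [->|/hp dj] := eqVneq p`_j 0; first by rewrite mul0r.
have [->|/hq ej] := eqVneq q`_(i - j) 0; first by rewrite mulr0.
by case: ne; rewrite dj ej -mulnDr subnKC // -ltnS.
Qed.

Fact poly_hpart_span p : exists (N : nat) (f : nat -> {poly K}),
  (forall d, poly_hpart d (f d)) /\ p = \sum_(d < N) f d.
Proof.
exists (n * size p)%N.
exists (fun d => if (n %| d)%N then p`_(d %/ n) *: 'X^(d %/ n) else 0).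
split=> [d|]; first by rewrite /poly_hpart; case: ifP => _ //; exists p`_(d %/ n).
apply/polyP => i; rewrite coef_sum.
have [lt|ge] := ltnP i (size p); last first.
  rewrite nth_default // big1 // => d _; case: ifP => _; rewrite ?coef0 //.
  rewrite coefZ coefXn; case: eqP => [<-|]; last by rewrite mulr0.
  by rewrite nth_default ?mul0r.
have lt' : (n * i < n * size p)%N by rewrite ltn_pmul2l.
rewrite (bigD1 (Ordinal lt')) //= dvdn_mulr // mulKn // coefZ coefXn eqxx mulr1.
rewrite big1 ?addr0 // => d /eqP ne; case: ifP => dvd; rewrite ?coef0 //.
rewrite coefZ coefXn; case: eqP => [e|]; last by rewrite mulr0.
by case: ne; apply: val_inj; rewrite /= e [RHS]mulnC (divnK dvd).
Qed.

Fact poly_hpart_indep (N : nat) (f : nat -> {poly K}) :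
  (forall d, poly_hpart d (f d)) -> \sum_(d < N) f d = 0 ->
  forall d, (d < N)%N -> f d = 0.
Proof.
move=> hf sf d lt; apply/polyP => i; rewrite coef0.
apply/eqP/negPn/negP => nz; have de := (poly_hpartP _ _).1 (hf d) i nz.
have := congr1 (fun p : {poly K} => p`_i) sf.
rewrite /= coef_sum coef0 (bigD1 (Ordinal lt)) //= big1 ?addr0.
  by move/eqP; apply/negP.
move=> e /eqP ne; apply/eqP/negPn/negP => nze.
have ee := (poly_hpartP _ _).1 (hf e) i nze.
by apply: ne; apply: val_inj; rewrite /= ee -de.
Qed.

Definition poly_grading : grading {poly K} :=
  Grading poly_hpart0 poly_hpartB poly_hpartM poly_hpart_span poly_hpart_indep.

End PolyGrading.

(* Main.v *)
(** A homogeneous generator [t] of the ideal of elements of positive degree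
    exists because a divisor of a nonzero homogeneous element is homogeneous.
    If [t] is nonzero, a nonzero [x] of degree 0 generates together with [t] a
    principal ideal whose generator has degree 0 and divides [t]; by the choice
    of [t] that generator is a unit, so [1 = x a + t b], and degree 0 parts show
    that [x] is invertible. Dividing by [t] repeatedly, every homogeneous
    element is a degree 0 multiple of a power of [t]. *)
Require Import Defs.
From HB Require Import structures.
From mathcomp Require Import all_boot all_order all_algebra.
From mathcomp Require Import boolp classical_sets.
Import GRing.Theory.
Local Open Scope classical_set_scope.
Local Open Scope ring_scope.

(** * Ideals generated by a set, and the cases of one and two generators *)

Section Ideals.
Context {R : comNzRingType}.
Implicit Types (S : set R) (a x y : R).

Lemma ideal_gen_ideal S : is_ideal (ideal_gen S).
Proof.
split.
- by move=> I [[]].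
- by move=> x y Sx Sy I IS; case: (IS) => [[_ ID _] _]; apply: ID; [apply: Sx|apply: Sy].
- by move=> a x Sx I IS; case: (IS) => [[_ _ IM] _]; apply: IM; apply: Sx.
Qed.

Lemma sub_ideal_gen S : S `<=` ideal_gen S.
Proof. exact: sub_smallest. Qed.

Lemma ideal_gen_min S (I : set R) : is_ideal I -> S `<=` I -> ideal_gen S `<=` I.
Proof. by move=> II SI; apply: smallest_sub. Qed.

Lemma ideal_gen_id (I : set R) : is_ideal I -> ideal_gen I = I.
Proof.
by move=> II; apply/seteqP; split; [exact: ideal_gen_min|exact: sub_ideal_gen].
Qed.

Lemma ideal_gen1 a x : ideal_gen [set a] x <-> exists b, x = a * b.
Proof.
split=> [|[b ->]]; last first.
  by rewrite mulrC; case: (ideal_gen_ideal [set a]) => _ _; apply; apply: sub_ideal_gen.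
move: x; apply: ideal_gen_min => [|x ->]; last by exists 1; rewrite mulr1.
split; first by exists 0; rewrite mulr0.
- by move=> x y [b ->] [c ->]; exists (b + c); rewrite mulrDr.
- by move=> c x [b ->]; exists (c * b); rewrite mulrCA.
Qed.

Lemma ideal_gen2 x y z :
  ideal_gen [set x; y] z -> exists a b, z = x * a + y * b.
Proof.
move: z; apply: ideal_gen_min => [|z [->|->]]; last 2 first.
- by exists 1, 0; rewrite mulr1 mulr0 addr0.
- by exists 0, 1; rewrite mulr1 mulr0 add0r.
split; first by exists 0, 0; rewrite !mulr0 addr0.
- move=> _ _ [a [b ->]] [c [d ->]]; exists (a + c), (b + d).
  by rewrite !mulrDr addrACA.
- by move=> c _ [a [b ->]]; exists (c * a), (c * b); rewrite mulrDr ![c * (_ * _)]mulrCA.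
Qed.

End Ideals.

(** Induction on [n]. For [n = 0], additivity of degrees over a domain makes both factors constant.
    Otherwise the product vanishes at 0, hence so does one factor, and an ['X] can be cancelled from
    it. *)
Lemma mul_eq_monomial {R : idomainType} (n : nat) (c : R) (p q : {poly R}) :
  c != 0 -> p * q = c *: 'X^n ->
  exists k l, [/\ (k + l)%N = n, p = p`_k *: 'X^k & q = q`_l *: 'X^l].
Proof.
move=> c0; elim: n p q => [|n IH] p q pq.
  have pq0 : p * q != 0 by rewrite pq expr0 alg_polyC polyC_eq0.
  have := pq0; rewrite mulf_eq0 negb_or => /andP[p0 q0].
  have := size_mul p0 q0; rewrite pq expr0 alg_polyC size_polyC c0 /=.
  move: p0 q0; rewrite -!size_poly_gt0 => p0 q0 sz.
  have [sp sq] : (size p <= 1)%N /\ (size q <= 1)%N.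
    by move: p0 q0 sz; case: (size p) => // [[|?]] _; case: (size q) => // [[|?]] _ //=;
      rewrite ?addnS ?addn0.
  by exists 0%N, 0%N; rewrite !expr0 !alg_polyC; split => //; apply: size1_polyC.
have X0 : 'X != 0 :> {poly R} by rewrite polyX_eq0.
have dvd (s : {poly R}) : s.[0] = 0 -> exists s', s = s' * 'X.
  move/eqP/factor_theorem => [s' ->]; exists s'.
  by rewrite subr0.
have /eqP : (p * q).[0] = 0 by rewrite pq hornerZ hornerXn expr0n mulr0.
rewrite hornerM mulf_eq0 => /orP[] /eqP /dvd [s def_s]; subst.
- have /IH[k [l [kl es eq]]] : s * q = c *: 'X^n.
    by apply: (mulIf X0); rewrite mulrAC pq exprSr scalerAl.
  exists k.+1, l; split=> //; first by rewrite addSn kl.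
  by rewrite coefMX /= [in LHS]es exprSr scalerAl.
- have /IH[k [l [kl ep es]]] : p * s = c *: 'X^n.
    by apply: (mulIf X0); rewrite -mulrA pq exprSr scalerAl.
  exists k, l.+1; split=> //; first by rewrite addnS kl.
  by rewrite coefMX /= [in LHS]es exprSr scalerAl.
Qed.

(** An element [x] with homogeneous components [x_i] is encoded by the
    polynomial [\sum_i x_i 'X^i], from which evaluation at 1 recovers [x]. *)
Section Decomposition.
Context {R : comNzRingType}.
Variable G : grading R.
Implicit Types (p q : {poly R}) (x y : R).

Definition graded_poly p := forall i, G i p`_i.

Lemma hpartD n x y : G n x -> G n y -> G n (x + y).
Proof. by move=> Gx Gy; rewrite -[y]opprK; apply: hpartB => //; apply: hpart_sub0. Qed.

Lemma hpart_sum n I (r : seq I) (P : pred I) (F : I -> R) :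
  (forall i, P i -> G n (F i)) -> G n (\sum_(i <- r | P i) F i).
Proof.
by move=> GF; elim/big_rec: _ => [|i x Pi Gx]; [exact: hpart0|apply: hpartD; auto].
Qed.

Lemma hpartX n x k : G n x -> G (n * k)%N (x ^+ k).
Proof.
move=> Gx; elim: k => [|k IH]; first by rewrite muln0 expr0; apply: hpart0_1.
by rewrite mulnS exprS; apply: hpartM.
Qed.

Lemma graded_polyD p q : graded_poly p -> graded_poly q -> graded_poly (p + q).
Proof. by move=> Gp Gq i; rewrite coefD; apply: hpartD. Qed.

Lemma graded_polyM p q : graded_poly p -> graded_poly q -> graded_poly (p * q).
Proof.
move=> Gp Gq i; rewrite coefM; apply: hpart_sum => j _.
by rewrite -{1}(subnKC (leq_ord j)); apply: hpartM.
Qed.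

Lemma graded_polyZXn n x : G n x -> graded_poly (x *: 'X^n).
Proof.
move=> Gx i; rewrite coefZ coefXn.
by case: eqP => [->|_]; rewrite ?mulr1 ?mulr0 //; apply: hpart0.
Qed.

Lemma graded_poly_exists x : exists2 p, graded_poly p & p.[1] = x.
Proof.
have [N [f [Gf ->]]] := hpart_span G x.
exists (\poly_(i < N) f i) => [i|].
  by rewrite coef_poly; case: ifP => _ //; apply: hpart0.
by rewrite horner_poly; apply: eq_bigr => i _; rewrite expr1n mulr1.
Qed.

(** The value at 1 is the sum of the coefficients, so directness of the sum makes each of them
    zero. *)
Lemma graded_poly_eq0 p : graded_poly p -> p.[1] = 0 -> p = 0.
Proof.
move=> Gp; rewrite horner_coef.
under eq_bigr do rewrite expr1n mulr1.
move=> s0; apply/polyP => i; rewrite coef0.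
by have [/(hpart_indep Gp s0)|/(nth_default 0)] := ltnP i (size p).
Qed.

Lemma graded_poly_inj p q :
  graded_poly p -> graded_poly q -> p.[1] = q.[1] -> p = q.
Proof.
move=> Gp Gq pq; apply/eqP; rewrite -subr_eq0; apply/eqP/graded_poly_eq0.
  by move=> i; rewrite coefB; apply: hpartB.
by rewrite hornerD hornerN pq subrr.
Qed.

Lemma horner1_ZXn x n : (x *: 'X^n).[1] = x.
Proof. by rewrite hornerZ hornerXn expr1n mulr1. Qed.

(** Both [x *: 'X^m] and [x *: 'X^n] encode [x], so they coincide. *)
Lemma hpart_inj x m n : x != 0 -> G m x -> G n x -> m = n.
Proof.
move=> x0 Gm Gn; apply/eqP/negPn/negP => /negPf mn.
have e : x *: 'X^m = x *: 'X^n.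
  by apply: graded_poly_inj; rewrite ?horner1_ZXn //; apply: graded_polyZXn.
move/(congr1 (fun p : {poly R} => p`_m)): e.
by rewrite !coefZ !coefXn eqxx mn mulr1 mulr0 => /eqP; apply/negP.
Qed.

(** * The ideal generated by the elements of positive degree *)

Definition irrelevant_ideal : set R :=
  ideal_gen [set x | exists2 n, (0 < n)%N & G n x].

(** The elements with zero component in degree 0 form an ideal that contains the generators, because
    constant coefficients multiply. *)
Lemma irrelevant_ideal_coef0 x :
  irrelevant_ideal x -> exists p, [/\ graded_poly p, p.[1] = x & p`_0 = 0].
Proof.
move: x; apply: ideal_gen_min => [|x [n n0 Gx]]; last first.
  exists (x *: 'X^n); rewrite horner1_ZXn; split=> //; first exact: graded_polyZXn.
  by rewrite coefZ coefXn; case: n n0 {Gx} => // n _; rewrite mulr0.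
split.
- by exists 0; rewrite horner0 coef0; split=> // i; rewrite coef0; apply: hpart0.
- move=> x y [p [Gp <- p0]] [q [Gq <- q0]]; exists (p + q).
  by rewrite hornerD coefD p0 q0 addr0; split=> //; apply: graded_polyD.
- move=> a x [p [Gp <- p0]]; have [q Gq <-] := graded_poly_exists a.
  exists (q * p); rewrite hornerM; split=> //; first exact: graded_polyM.
  by rewrite coefM big_ord1 p0 mulr0.
Qed.

(** An element of degree 0 is its own component in degree 0, which vanishes on the irrelevant
    ideal. *)
Lemma irrelevant_ideal_gt0 n x :
  x != 0 -> G n x -> irrelevant_ideal x -> (0 < n)%N.
Proof.
case: n => // x0 Gx /irrelevant_ideal_coef0[p [Gp px p0]].
have pE : p = x *: 'X^0.
  by apply: graded_poly_inj; rewrite ?horner1_ZXn //; apply: graded_polyZXn.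
by move: p0 x0; rewrite pE coefZ coefXn mulr1 => ->; rewrite eqxx.
Qed.

End Decomposition.

(** * Divisors of homogeneous elements in a graded domain *)

Section GradedDomain.
Context {R : idomainType}.
Variable G : grading R.
Implicit Types (a b x y t : R).

(** The encodings of [a] and [b] multiply to the monomial that encodes [a * b], so both are
    monomials. *)
Lemma hpart_divisors n a b :
  a * b != 0 -> G n (a * b) -> exists k l, [/\ (k + l)%N = n, G k a & G l b].
Proof.
move=> ab0 Gab; have [p Gp pa] := graded_poly_exists G a.
have [q Gq qb] := graded_poly_exists G b.
have pqE : p * q = (a * b) *: 'X^n.
  apply: (graded_poly_inj G); [exact: graded_polyM|exact: graded_polyZXn|].
  by rewrite horner1_ZXn hornerM pa qb.
have [k [l [kl pE qE]]] := mul_eq_monomial _ _ _ _ ab0 pqE.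
by exists k, l; rewrite -pa -qb pE qE !horner1_ZXn.
Qed.

(** The generator divides [x], so it is nonzero and homogeneous; as a member of the irrelevant ideal
    it cannot have degree 0. *)
Lemma homogeneous_generator n x t :
  irrelevant_ideal G = ideal_gen [set t] -> (0 < n)%N -> x != 0 -> G n x ->
  t != 0 /\ exists2 m, (0 < m)%N & G m t.
Proof.
move=> It n0 x0 Gx.
have [b xE] : exists b, x = t * b.
  by apply/ideal_gen1; rewrite -It; apply: sub_ideal_gen; exists n.
have t0 : t != 0 by apply: contraNneq x0; rewrite xE => ->; rewrite mul0r.
rewrite xE in x0 Gx; have [m [_ [_ Gt _]]] := hpart_divisors _ _ _ x0 Gx.
split=> //; exists m => //; apply: irrelevant_ideal_gt0 Gt _ => //.
by rewrite It; apply: sub_ideal_gen.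
Qed.

(** * Consequences of a nonzero homogeneous generator [t] of degree [n] *)

Section HomogeneousGenerator.
Variables (t : R) (n : nat).
Hypotheses (It : irrelevant_ideal G = ideal_gen [set t]) (t0 : t != 0).
Hypotheses (n0 : (0 < n)%N) (Gt : G n t).

Lemma hpart_div_generator m y : (0 < m)%N -> y != 0 -> G m y ->
  exists k z, [/\ m = (n + k)%N, G k z & y = t * z].
Proof.
move=> m0 y0 Gy.
have [z yE] : exists z, y = t * z.
  by apply/ideal_gen1; rewrite -It; apply: sub_ideal_gen; exists m.
rewrite yE in y0 Gy; have [n' [k [<- Gt' Gz]]] := hpart_divisors _ _ _ y0 Gy.
by exists k, z; split=> //; rewrite (hpart_inj _ _ _ _ t0 Gt Gt').
Qed.

Lemma hpart_generatorX m y : y != 0 -> G m y ->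
  exists k c, [/\ m = (n * k)%N, G 0%N c & y = c * t ^+ k].
Proof.
elim/ltn_ind: m y => m IH y y0 Gy.
have [m0|m_gt0] := posnP m.
  by exists 0%N, y; rewrite muln0 expr0 mulr1 -{2}m0.
have [j [z [mE Gz yE]]] := hpart_div_generator _ _ m_gt0 y0 Gy.
have z0 : z != 0 by apply: contraNneq y0; rewrite yE => ->; rewrite mulr0.
have lt_jm : (j < m)%N by rewrite mE -{1}[j]add0n ltn_add2r.
have [k [c [jE Gc zE]]] := IH j lt_jm z z0 Gz.
by exists k.+1, c; rewrite mulnS -jE exprS mulrCA -zE.
Qed.

Lemma hpart0_unit x : is_graded_pid G -> x != 0 -> G 0%N x ->
  exists2 y, G 0%N y & x * y = 1.
Proof.
move=> pidG x0 Gx.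
have [|d Id] := pidG (ideal_gen [set x; t]).
  by exists [set x; t] => // z [] ->; [exists 0%N|exists n].
have [u xE] : exists u, x = d * u.
  by apply/ideal_gen1; rewrite -Id; apply: sub_ideal_gen; left.
have [v tE] : exists v, t = d * v.
  by apply/ideal_gen1; rewrite -Id; apply: sub_ideal_gen; right.
(* The degrees of [d] and its cofactor [u] add up to 0. *)
have Gd : G 0%N d.
  have := Gx; rewrite xE => /hpart_divisors; rewrite -xE => /(_ x0).
  by move=> [[|k] [l []]].
(* Since [d] has degree 0, the cofactor [v] of [t] has degree [n > 0] and is itself a multiple
   [t * z]. Cancelling [t] in [t = d * (t * z)] shows that [d] is a unit. *)
have [z z1] : exists z, d * z = 1.
  have v0 : v != 0 by apply: contraNneq t0; rewrite tE => ->; rewrite mulr0.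
  have Gv : G n v.
    have := Gt; rewrite {1}tE => /hpart_divisors; rewrite -tE => /(_ t0).
    move=> [k [l [<- Gk]]]; suff -> : k = 0%N by [].
    apply: (hpart_inj G d) => //.
    by apply: contraNneq t0; rewrite tE => ->; rewrite mul0r.
  have [_ [z [_ _ vE]]] := hpart_div_generator _ _ n0 v0 Gv.
  by exists z; apply: (mulfI t0); rewrite mulr1 {2}tE vE mulrCA.
have [a [b e1]] : exists a b, 1 = x * a + t * b.
  by apply: ideal_gen2; rewrite Id; apply/ideal_gen1; exists z.
have [p Gp pa] := graded_poly_exists G a.
have [q Gq qb] := graded_poly_exists G b.
(* The inverse is the degree 0 component of [a]: in degree 0 of [1 = x * a + t * b] the second
   summand contributes nothing, because [n > 0]. *)
exists p`_0; first exact: Gp.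
have : x *: 'X^0 * p + t *: 'X^n * q = 1 *: 'X^0.
  apply: (graded_poly_inj G).
  - by apply: graded_polyD; apply: graded_polyM => //; apply: graded_polyZXn.
  - exact/graded_polyZXn/hpart0_1.
  - by rewrite hornerD !hornerM !horner1_ZXn pa qb.
move/(congr1 (fun r : {poly R} => r`_0)).
rewrite coefD !coefM !big_ord1 !coefZ !coefXn eqxx (ltn_eqF n0) !mulr1.
by rewrite mulr0 mul0r addr0.
Qed.

Lemma degree0_is_field : is_graded_pid G -> is_field (degree0 G).
Proof.
move=> pidG x x0.
have [||y Gy xy] := hpart0_unit (val x) pidG.
- by apply: contraNneq x0 => vx; apply/eqP/val_inj; rewrite vx rmorph0.
- exact/asboolP/(valP x).
have Py : y \in in_hpart0 G by apply/asboolP.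
by exists (Sub y Py); apply: val_inj.
Qed.

(** * The isomorphism, built as evaluation at [t] from polynomials to [R] and inverted at the end *)

Let eval_t (p : {poly degree0 G}) : R := (map_poly val p).[t].

Local Lemma eval_t_is_zmod : zmod_morphism eval_t.
Proof. by move=> p q; rewrite /eval_t rmorphB hornerD hornerN. Qed.

Local Lemma eval_t_is_monoid : monoid_morphism eval_t.
Proof.
by split=> [|p q]; rewrite /eval_t ?rmorph1 ?hornerC // rmorphM hornerM.
Qed.

Local Lemma eval_tZXn c k : eval_t (c *: 'X^k) = val c * t ^+ k.
Proof. by rewrite /eval_t map_polyZ map_polyXn hornerZ hornerXn. Qed.

(** Substituting [t *: 'X^n] for the variable turns [p] into the encoding [q] of its value at [t],
    so [q = 0]. As [n > 0], the coefficient of [q] at [n * i] is the single term [p_i * t ^+ i], and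
    [t] is not a zero divisor. *)
Local Lemma eval_t_eq0 p : eval_t p = 0 -> p = 0.
Proof.
move=> pt0.
pose q : {poly R} := map_poly val p \Po (t *: 'X^n).
have qE : q = \sum_(i < size p) (val p`_i * t ^+ i) *: 'X^(n * i).
  rewrite /q comp_polyE size_map_inj_poly ?rmorph0 //; last exact: val_inj.
  apply: eq_bigr => i _; rewrite coef_map exprZn -exprM.
  by rewrite scalerA.
have Gq : graded_poly G q.
  rewrite qE => i; rewrite coef_sum; apply: hpart_sum => j _.
  apply: graded_polyZXn; rewrite -[X in G X]add0n; apply: hpartM; last exact: hpartX.
  exact/asboolP/(valP p`_j).
have q0 : q = 0.
  by apply: (graded_poly_eq0 G) => //; rewrite /q horner_comp horner1_ZXn.
apply/polyP => i; rewrite coef0; apply: val_inj; rewrite rmorph0.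
have [lt_ip|] := ltnP i (size p); last by move/(nth_default 0) ->; rewrite rmorph0.
have /(congr1 (fun r : {poly R} => r`_(n * i))) := qE.
rewrite q0 coef0 coef_sum (bigD1 (Ordinal lt_ip)) //= coefZ coefXn eqxx mulr1.
rewrite big1 ?addr0 => [/esym/eqP|j ne_ji].
  by rewrite mulf_eq0 expf_eq0 (negPf t0) andbF orbF => /eqP.
rewrite coefZ coefXn eqn_pmul2l // eq_sym; case: eqP => [ji|]; last by rewrite mulr0.
by move/eqP: ne_ji; case; apply: val_inj.
Qed.

Local Lemma eval_t_inj : injective eval_t.
Proof.
move=> p q pq; apply/eqP; rewrite -subr_eq0; apply/eqP/eval_t_eq0.
by rewrite eval_t_is_zmod pq subrr.
Qed.

Local Lemma eval_t_hpart m y : G m y ->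
  exists2 p, poly_hpart n m p & eval_t p = y.
Proof.
(* Zero is treated apart: it has every degree [m], also those that [n] does not divide. *)
have [-> _|y0 /(hpart_generatorX _ _ y0)[k [c [-> Gc ->]]]] := eqVneq y 0.
  by exists 0; [exact: poly_hpart0|rewrite /eval_t rmorph0 horner0].
have Pc : c \in in_hpart0 G by apply/asboolP.
exists (Sub c Pc *: 'X^k); last by rewrite eval_tZXn SubK.
by rewrite /poly_hpart dvdn_mulr // mulKn //; exists (Sub c Pc).
Qed.

Local Lemma hpart_eval_t m p : poly_hpart n m p -> G m (eval_t p).
Proof.
rewrite /poly_hpart; case: ifPn => [dvd_nm [c ->]|_ ->].
  rewrite eval_tZXn -{1}(divnK dvd_nm) mulnC -[X in G X]add0n.
  apply: hpartM; last exact: hpartX.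
  exact/asboolP/(valP c).
by rewrite /eval_t rmorph0 horner0; apply: hpart0.
Qed.

Local Lemma eval_t_surj y : exists p, eval_t p = y.
Proof.
have [N [f [Gf ->]]] := hpart_span G y.
elim: N => [|N [p pE]].
  by exists 0; rewrite big_ord0 /eval_t rmorph0 horner0.
have [q _ qE] := eval_t_hpart _ _ (Gf N).
by exists (p + q); rewrite big_ord_recr -pE -qE /eval_t rmorphD hornerD.
Qed.

Lemma graded_isomorphic_poly : graded_isomorphic G (poly_grading (degree0 G) n0).
Proof.
(* Chosen preimages form a right inverse, which injectivity makes two-sided; the inverse of a
   bijective ring morphism is again a morphism. *)
have [f ft] := choice eval_t_surj.
have tf : cancel eval_t f by move=> p; apply: eval_t_inj; rewrite ft.
pose eval_tA := GRing.isZmodMorphism.Build _ _ _ eval_t_is_zmod.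
pose eval_tM := GRing.isMonoidMorphism.Build _ _ _ eval_t_is_monoid.
pose ev : {rmorphism {poly degree0 G} -> R} := HB.pack eval_t eval_tA eval_tM.
have evf : cancel ev f by exact: tf.
have fev : cancel f ev by exact: ft.
pose fA := GRing.isZmodMorphism.Build _ _ f (can2_zmod_morphism evf fev).
pose fM := GRing.isMonoidMorphism.Build _ _ f (can2_monoid_morphism evf fev).
pose fR : {rmorphism R -> {poly degree0 G}} := HB.pack f fA fM.
exists fR; split; first by exists ev.
move=> m; apply/seteqP; split=> [_ [y Gy <-]|p Hp] /=.
  by have [p Hp <-] := eval_t_hpart _ _ Gy; rewrite /fR /= tf.
by exists (eval_t p); [exact: hpart_eval_t|exact: tf].
Qed.

End HomogeneousGenerator.

(** * The case without nonzero elements of positive degree *)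

(** Every element is homogeneous of degree 0, so each ideal, taken as its own generating set, is
    homogeneous. *)
Lemma zero_grading_pid :
  is_graded_pid G -> is_zero_grading G -> is_pid R.
Proof.
move=> pidG [G0 _] I idI; apply: pidG; exists I; last by rewrite ideal_gen_id.
by move=> x _; exists 0%N; rewrite G0.
Qed.

Lemma zero_grading_of_trivial :
  (forall n x, (0 < n)%N -> G n x -> x = 0) -> is_zero_grading G.
Proof.
move=> G_gt0; split=> [|n n0]; apply/seteqP; split=> // x.
- move=> _; have [N [f [Gf ->]]] := hpart_span G x; apply: hpart_sum => -[[|i] lt_iN] _ //=.
  by rewrite (G_gt0 i.+1 _ _ (Gf i.+1)) //; apply: hpart0.
- exact: G_gt0.
- by move=> ->; apply: hpart0.
Qed.

End GradedDomain.

Theorem proposition3p1 (R : idomainType) (G : grading R)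
    (hG : is_graded_pid G) :
  (is_zero_grading G /\ is_pid R) \/
  (is_field (degree0 G) /\
   exists (n : nat) (n_gt0 : (0 < n)%N),
     graded_isomorphic G (poly_grading (degree0 G) n_gt0)).
Proof.
(* The two alternatives are told apart by whether some nonzero element has positive degree; such an
   element forces [t] to be nonzero. *)
have [[m [x [m0 Gx x0]]]|noG] :=
    pselect (exists m x, [/\ (0 < m)%N, G m x & x != 0]); last first.
  left; have ZG : is_zero_grading G.
    apply: zero_grading_of_trivial => m x m0 Gx.
    by apply/eqP/negPn/negP => x0; apply: noG; exists m, x.
  by split=> //; apply: zero_grading_pid hG ZG.
right; have [|t It] := hG (irrelevant_ideal G).
  by exists [set y | exists2 k, (0 < k)%N & G k y] => // y [k _ Gy]; exists k.
have [t0 [n n0 Gt]] := homogeneous_generator _ _ _ _ It m0 x0 Gx.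
split; first exact: (degree0_is_field G t n).
by exists n, n0; apply: (graded_isomorphic_poly G t n).
Qed.
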